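(* Let $K\ge 2$, let $\boldsymbol\alpha=(\alpha_1,\dots,\alpha_K)$ with all $\alpha_i>0$, and let $\boldsymbol\theta=(\theta_1,\dots,\theta_K)\sim\mathrm{Dir}(\boldsymbol\alpha)$. For a ranking $\pi$ (a bijection $\{1,\dots,K\}\to\{1,\dots,K\}$) define $$\tau(\pi,\pi^* )=\frac{2}{K(K-1)}\sum_{i\neq j}\mathbf 1_{\{\pi(i)>\pi(j)\}}\mathbf 1_{\{\theta_i>\theta_j\}} .$$ Let $$\Pi_{\boldsymbol\alpha}=\{\pi:\ \pi \text{ is a ranking of }\{1,\dots,K\}\text{ such that, for all } i,j,\ \pi(i)>\pi(j)\text{ only if }\alpha_i\ge\alpha_j\}.$$ Then $$\Pi_{\boldsymbol\alpha}=\mathop{\arg\max}_{\pi}\ \mathbb E\big[\tau(\pi,\pi^* )\,\big|\,\boldsymbol\theta\sim\mathrm{Dir}(\boldsymbol\alpha)\big],$$ where the maximum is over all rankings $\pi$ of $\{1,\dots,K\}$; in particular every ranking obtained by sorting the components of $\boldsymbol\alpha$ in decreasing order (ties broken arbitrarily) maximizes the expected value of $\tau$, and all such rankings achieve the same expected value.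
   Context: $\mathrm{Dir}(\boldsymbol\alpha)$ is the Dirichlet distribution on the open simplex $\{\boldsymbol\theta\in\mathbb R^K:\sum_i\theta_i=1,\theta_i>0\}$ with density $\frac{1}{\mathrm B(\boldsymbol\alpha)}\prod_i\theta_i^{\alpha_i-1}$. The ''true ranking'' $\pi^*$ is determined by $\boldsymbol\theta$ via $\pi^*(i)>\pi^*(j)$ iff $\theta_i>\theta_j$ (a higher rank value means more preferred); $\tau(\pi,\pi^* )$ is the normalized Kendall's tau agreement between $\pi$ and $\pi^*$, and the expectation is over $\boldsymbol\theta$. *)

(* Defs.v *)
From HB Require Import structures.
From mathcomp Require Import all_boot all_order all_algebra all_fingroup.
From mathcomp Require Import all_classical all_reals all_analysis.
Set Implicit Arguments. Unset Strict Implicit. Unset Printing Implicit Defensive.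
Import Order.TTheory GRing.Theory Num.Theory.
Local Open Scope ring_scope.

Section Dirichlet.
Variable R : realType.

(* Iterated Lebesgue integral over R^n of a (nonnegative) extended-real
   function of the coordinates v 0, ..., v (n-1) (coordinates >= n are 0).
   For nonnegative measurable integrands this is the Lebesgue integral on R^n
   (Tonelli). *)
Fixpoint iter_int (n : nat) (F : (nat -> R) -> \bar R) : \bar R :=
  match n with
  | 0 => F (fun _ => 0)
  | n'.+1 => (\int[@lebesgue_measure R]_(x in [set: R])
               iter_int n' (fun g => F (fun i => if i is k.+1 then g k else x)))%E
  end.

(* Point of the hyperplane {sum theta = 1} parameterized by its first K-1
   coordinates. *)
Definition theta_of (K : nat) (v : nat -> R) : 'I_K -> R :=
  fun i => if (i < K.-1)%N then v i else 1 - \sum_(k < K.-1) v k.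

Definition dir_weight (K : nat) (alpha : 'I_K -> R) (v : nat -> R) : R :=
  if [forall i, 0 < @theta_of K v i]
  then \prod_(i < K) powR (@theta_of K v i) (alpha i - 1) else 0.

Definition dir_const (K : nat) (alpha : 'I_K -> R) : R :=
  fine (iter_int K.-1 (fun v => (dir_weight alpha v)%:E)).

Definition ktau (K : nat) (pi : {perm 'I_K}) (theta : 'I_K -> R) : R :=
  (2 / (K%:R * (K%:R - 1))) *
  \sum_(i < K) \sum_(j < K | i != j)
     (((pi j : nat) < pi i)%N && (theta j < theta i))%:R.

Definition exp_tau (K : nat) (alpha : 'I_K -> R) (pi : {perm 'I_K}) : \bar R :=
  iter_int K.-1 (fun v =>
    (ktau pi (@theta_of K v) * (dir_weight alpha v / dir_const alpha))%:E).

Definition Pi_alpha (K : nat) (alpha : 'I_K -> R) (pi : {perm 'I_K}) : Prop :=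
  forall i j : 'I_K, ((pi j : nat) < pi i)%N -> alpha j <= alpha i.

End Dirichlet.

(* Main.v *)
(* By linearity, the expected agreement is a positive multiple of
   [\sum_(pi j < pi i) P(theta_j < theta_i)], in which each pair {i, j}
   contributes one of P(theta_j < theta_i) and P(theta_i < theta_j).  Exchanging
   theta_i and theta_j preserves Lebesgue measure on the simplex and turns the
   density w into w', where for theta_j < theta_i the ratio
   w / w' = (theta_i / theta_j)^(alpha_i - alpha_j) lies on the same side of 1
   as alpha_i - alpha_j on that of 0.  So a larger alpha gets the larger
   probability, strictly so when the alphas differ, and a ranking is optimal iff
   it is optimal on every pair, since sorting alpha achieves this.
   The simplex is parameterized by its first n coordinates; the exchange of
   theta_i with the last one is a reflection of the i-th integration variable,
   and these exchanges generate all permutations.  The density is integrable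
   because some theta_i is at least 1/(n+1): moving it to the last place, the
   remaining factors are bounded by a product of integrable powers on ]0, 1]. *)
Require Import Defs.
From HB Require Import structures.
From mathcomp Require Import all_boot all_order all_algebra all_fingroup.
From mathcomp Require Import all_classical all_reals all_analysis.
From mathcomp Require Import measurable_realfun ring lra.
Set Implicit Arguments. Unset Strict Implicit. Unset Printing Implicit Defensive.
Import Order.TTheory GRing.Theory Num.Theory.
Import numFieldNormedType.Exports.
Local Open Scope classical_set_scope.
Local Open Scope ring_scope.

(** * Iterated Lebesgue integrals *)

Section IteratedIntegral.
Context {R : realType}.
Local Notation mu := (@lebesgue_measure R).

(* Quantifying over all measurable families of arguments makes partial
   integration preserve this property without putting a sigma-algebra on
   [I -> R]. *)
Definition measurable_op (I : Type) (F : (I -> R) -> \bar R) : Prop :=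
  forall d (T : measurableType d) (g : T -> I -> R),
    (forall i, measurable_fun [set: T] (g^~ i)) ->
    measurable_fun [set: T] (fun t => F (g t)).

Definition scons (x : R) (g : nat -> R) : nat -> R :=
  fun i => if i is k.+1 then g k else x.

Lemma iter_intS n (F : (nat -> R) -> \bar R) :
  iter_int n.+1 F =
  (\int[mu]_(x in [set: R]) iter_int n (fun g => F (scons x g)))%E.
Proof. by []. Qed.

Lemma measurable_scons d (T : measurableType d) (f : T -> R)
    (g : T -> nat -> R) :
  measurable_fun [set: T] f -> (forall i, measurable_fun [set: T] (g^~ i)) ->
  forall i, measurable_fun [set: T] (fun t => scons (f t) (g t) i).
Proof. by move=> mf mg [|i]; [exact: mf|exact: mg]. Qed.

Lemma measurable_op_scons (F : (nat -> R) -> \bar R) x :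
  measurable_op F -> measurable_op (fun g => F (scons x g)).
Proof.
move=> mF d T g mg; apply: (mF _ _ (fun t => scons x (g t))).
exact: measurable_scons.
Qed.

Lemma iter_int_ge0 n (F : (nat -> R) -> \bar R) :
  (forall v, (0 <= F v)%E) -> (0 <= iter_int n F)%E.
Proof.
elim: n F => [|n IH] F F0; first exact: F0.
by rewrite iter_intS; apply: integral_ge0 => x _; apply: IH.
Qed.

(** The integrand carries a parameter in an arbitrary measurable space, so that the induction can
    add the outermost variable to that parameter; Tonelli then makes the partial integral
    measurable. *)
Lemma measurable_iter_int n d (T : measurableType d)
    (F : T -> (nat -> R) -> \bar R) :
  (forall d' (T' : measurableType d') (s : T' -> T) (g : T' -> nat -> R),
    measurable_fun [set: T'] s -> (forall i, measurable_fun [set: T'] (g^~ i)) ->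
    measurable_fun [set: T'] (fun t => F (s t) (g t))) ->
  (forall t v, (0 <= F t v)%E) ->
  measurable_fun [set: T] (fun t => iter_int n (F t)).
Proof.
elim: n d T F => [|n IH] d T F mF F0 /=.
  exact: (mF _ T id (fun _ _ => 0)).
apply: (@measurable_fun_fubini_tonelli_F _ _ T (measurableTypeR R) R mu
  (fun p => iter_int n (fun g => F p.1 (scons p.2 g)))); last first.
  by move=> p; apply: iter_int_ge0.
apply: (IH _ _ (fun (p : T * measurableTypeR R) g => F p.1 (scons p.2 g))).
- move=> d' T' s g ms mg.
  apply: (mF _ _ (fun t => (s t).1) (fun t => scons (s t).2 (g t))).
    exact: (measurableT_comp measurable_fst).
  apply: measurable_scons => //.
  exact: (measurableT_comp measurable_snd).
- by move=> p v; apply: F0.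
Qed.

Lemma measurable_op_iter_int n (F : (nat -> R) -> \bar R) :
  measurable_op F -> (forall v, (0 <= F v)%E) ->
  measurable_fun [set: measurableTypeR R] (fun x => iter_int n (fun g => F (scons x g))).
Proof.
move=> mF F0; apply: (@measurable_iter_int n _ (measurableTypeR R) (fun x g => F (scons x g))).
- move=> d T s g ms mg; apply: (mF _ _ (fun t => scons (s t) (g t))).
  exact: measurable_scons.
- by move=> x v; apply: F0.
Qed.

(** Tonelli exchanges the outermost variable with the next one, and the induction carries it inwards
    past the others, so coordinate 0 becomes the innermost one. *)
Lemma iter_intSr n (F : (nat -> R) -> \bar R) :
  measurable_op F -> (forall v, (0 <= F v)%E) ->
  iter_int n.+1 F =
  iter_int n (fun g => \int[mu]_(x in [set: R]) F (scons x g))%E.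
Proof.
elim: n F => [//|n IH] F mF F0.
transitivity (\int[mu]_(y in [set: R]) \int[mu]_(x in [set: R])
    iter_int n (fun g => F (scons x (scons y g))))%E.
  rewrite iter_intS.
  apply: (@fubini_tonelli _ _ (measurableTypeR R) (measurableTypeR R) R mu mu
    (fun p => iter_int n (fun g => F (scons p.1 (scons p.2 g))))).
  - apply: (@measurable_iter_int n _ (measurableTypeR R * measurableTypeR R)%type
      (fun p g => F (scons p.1 (scons p.2 g)))).
    + move=> d T s g ms mg.
      apply: (mF _ _ (fun t => scons (s t).1 (scons (s t).2 (g t)))).
      apply: measurable_scons; first exact: (measurableT_comp measurable_fst).
      apply: measurable_scons => //.
      exact: (measurableT_comp measurable_snd).
    + by move=> p v; apply: F0.
  - by move=> p; apply: iter_int_ge0.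
rewrite [RHS]iter_intS; apply: eq_integral => y _.
(* With [y] frozen, [x] becomes coordinate 0 of an integrand in one variable fewer. *)
pose G v := F (scons (v 0%N) (scons y (fun i => v i.+1))).
have -> : (\int[mu]_(x in [set: R]) iter_int n (fun g => F (scons x (scons y g))))%E
  = iter_int n.+1 G by [].
rewrite IH // => [|v]; last exact: F0.
move=> d T g mg.
apply: (mF _ _ (fun t => scons (g t 0%N) (scons y (fun i => g t i.+1)))).
by apply: measurable_scons => //; apply: measurable_scons.
Qed.

Lemma le_iter_int n (F G : (nat -> R) -> \bar R) :
  measurable_op F -> measurable_op G -> (forall v, (0 <= F v)%E) ->
  (forall v, (F v <= G v)%E) -> (iter_int n F <= iter_int n G)%E.
Proof.
elim: n F G => [|n IH] F G mF mG F0 FG; first exact: FG.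
have G0 v : (0 <= G v)%E by apply: le_trans (FG v).
rewrite !iter_intS; apply: ge0_le_integral => //.
- by move=> x _; apply: iter_int_ge0.
- exact: measurable_op_iter_int.
- exact: measurable_op_iter_int.
- by move=> x _; apply: IH => //; apply: measurable_op_scons.
Qed.

Lemma iter_intD n (F G : (nat -> R) -> \bar R) :
  measurable_op F -> measurable_op G -> (forall v, (0 <= F v)%E) ->
  (forall v, (0 <= G v)%E) ->
  iter_int n (fun v => F v + G v)%E = (iter_int n F + iter_int n G)%E.
Proof.
elim: n F G => [//|n IH] F G mF mG F0 G0.
rewrite !iter_intS -ge0_integralD //.
- by apply: eq_integral => x _; apply: IH => //; apply: measurable_op_scons.
- by move=> x _; apply: iter_int_ge0.
- exact: measurable_op_iter_int.
- by move=> x _; apply: iter_int_ge0.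
- exact: measurable_op_iter_int.
Qed.

Lemma iter_int0 n : iter_int n (fun _ : nat -> R => 0%E) = 0%E.
Proof.
elim: n => [//|n IH]; rewrite iter_intS.
by apply: integral0_eq => x _; apply: IH.
Qed.

Lemma measurable_op_sum (I J : Type) (s : seq J) (F : J -> (I -> R) -> \bar R) :
  (forall j, measurable_op (F j)) ->
  measurable_op (fun v => \sum_(j <- s) F j v)%E.
Proof.
by move=> mF d T g mg; apply: emeasurable_sum => j; apply: mF.
Qed.

Lemma iter_int_sum (J : Type) (s : seq J) n (F : J -> (nat -> R) -> \bar R) :
  (forall j, measurable_op (F j)) -> (forall j v, (0 <= F j v)%E) ->
  iter_int n (fun v => \sum_(j <- s) F j v)%E =
  (\sum_(j <- s) iter_int n (F j))%E.
Proof.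
move=> mF F0; elim: s => [|j s IH].
  rewrite big_nil -[RHS](iter_int0 n); congr iter_int.
  by apply/funext => v; rewrite big_nil.
rewrite big_cons -IH -iter_intD //.
- by congr iter_int; apply/funext => v; rewrite big_cons.
- exact: measurable_op_sum.
- by move=> v; apply: sume_ge0.
Qed.

Lemma iter_intZl n (c : R) (F : (nat -> R) -> \bar R) : 0 <= c ->
  measurable_op F -> (forall v, (0 <= F v)%E) ->
  iter_int n (fun v => c%:E * F v)%E = (c%:E * iter_int n F)%E.
Proof.
move=> c0; elim: n F => [//|n IH] F mF F0.
rewrite !iter_intS -ge0_integralZl //.
- by apply: eq_integral => x _; apply: IH => //; apply: measurable_op_scons.
- exact: measurable_op_iter_int.
- by move=> x _; apply: iter_int_ge0.
Qed.

(** * Strict positivity of integrals *)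

Lemma integral_gt0_itv (f : R -> \bar R) (a b : R) : a < b ->
  measurable_fun [set: R] f -> (forall x, (0 <= f x)%E) ->
  (forall x, a < x < b -> (0 < f x)%E) ->
  (0 < \int[mu]_(x in [set: R]) f x)%E.
Proof.
move=> ab mf f0 fp.
rewrite lt_def integral_ge0 ?andbT//; apply/negP => /eqP int0.
(* A zero integral makes [f] vanish almost everywhere, so the interval would lie in a null set. *)
have : (\int[mu]_(x in [set: R]) `|f x|)%E = 0%E.
  by rewrite -int0; apply: eq_integral => x _; rewrite gee0_abs.
move/(ae_eq_integral_abs mu measurableT mf) => [N [mN N0 sub]].
have : (mu `]a, b[ <= mu N)%E.
  apply: le_measure; rewrite ?inE//.
  move=> x /=; rewrite in_itv/= => xab; apply: sub => /= /(_ I) fx0.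
  by have := fp _ xab; rewrite fx0 ltxx.
by rewrite N0 lebesgue_measure_itv/= lte_fin ab -EFinD lee_fin subr_le0 leNgt ab.
Qed.

Lemma iter_int_gt0 n (F : (nat -> R) -> \bar R) (a b : nat -> R) :
  measurable_op F -> (forall v, (0 <= F v)%E) ->
  (forall k, (k < n)%N -> a k < b k) ->
  (forall v, (forall k, (k < n)%N -> a k < v k < b k) -> (0 < F v)%E) ->
  (0 < iter_int n F)%E.
Proof.
elim: n F a b => [|n IH] F a b mF F0 ab Fp; first exact: Fp.
rewrite iter_intS; apply: (@integral_gt0_itv _ (a 0%N) (b 0%N)).
- exact: ab.
- exact: measurable_op_iter_int.
- by move=> x; apply: iter_int_ge0.
move=> x xab; apply: (IH _ (fun k => a k.+1) (fun k => b k.+1)) => //.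
- exact: measurable_op_scons.
- by move=> k kn; apply: ab.
- by move=> v vab; apply: Fp => -[|k] // kn; apply: vab.
Qed.

(** * Reflection of one integration variable *)

Lemma lebesgue_measure_reflect (c : R) (A : set R) : measurable A ->
  pushforward mu ((fun x => c - x) : _ -> measurableTypeR R) A = mu A.
Proof.
move=> mA.
have mc : measurable_fun [set: measurableTypeR R]
    ((fun x => c - x) : _ -> measurableTypeR R) by apply: measurable_funB.
(* By uniqueness of Lebesgue measure it suffices to compare half-open intervals; reflection
   exchanges the endpoints and keeps the length. *)
apply/esym/lebesgue_measure_unique => //= _ [[a b]] _ <-.
rewrite /pushforward.
have -> : (fun x => c - x) @^-1` `]a, b]%classic = `[c - b, c - a[%classic.
  by apply/seteqP; split => x /=; rewrite !in_itv/=; lra.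
rewrite !lebesgue_measure_itv/= !lte_fin ltrD2l ltrN2.
by case: ifP => // _; rewrite -!EFinD; congr EFin; ring.
Qed.

Lemma integral_reflect (c : R) (f : R -> \bar R) :
  measurable_fun [set: R] f -> (forall x, (0 <= f x)%E) ->
  (\int[mu]_(x in [set: R]) f (c - x)%R = \int[mu]_(x in [set: R]) f x)%E.
Proof.
move=> mf f0.
have mc : measurable_fun [set: measurableTypeR R]
    ((fun x => c - x) : _ -> measurableTypeR R) by apply: measurable_funB.
have := @ge0_integral_pushforward _ _ _ _ R _ mc mu setT f measurableT mf.
rewrite preimage_setT => <-; last by move=> x _; apply: f0.
by apply: eq_measure_integral => //= A mA _; exact: lebesgue_measure_reflect.
Qed.

Definition upd (v : nat -> R) (k : nat) (x : R) : nat -> R :=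
  fun i => if i == k then x else v i.

(* Fubini-Tonelli moves the reflected coordinate to the innermost integral. *)
Lemma iter_int_reflect n k (phi : (nat -> R) -> R) (F : (nat -> R) -> \bar R) :
  (k < n)%N -> measurable_op F -> (forall v, (0 <= F v)%E) ->
  measurable_op (fun v => (phi v)%:E) ->
  (forall v x, phi (upd v k x) = phi v) ->
  iter_int n (fun v => F (upd v k (phi v - v k))) = iter_int n F.
Proof.
elim: n k phi F => [//|n IH] [|k] phi F kn mF F0 mphi phik.
  have mG : measurable_op (fun v => F (upd v 0 (phi v - v 0%N))).
    move=> d T g mg; apply: (mF _ _ (fun t => upd (g t) 0 (phi (g t) - g t 0%N))).
    move=> [|i]; rewrite /upd //=.
    apply: measurable_funB; last exact: mg.
    exact/measurable_EFinP/(mphi _ _ g).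
  rewrite !iter_intSr //.
  congr iter_int; apply/funext => g.
  (* As [phi] ignores coordinate 0, its value at [scons x g] is the one at [scons 0 g], a constant
     of the inner integral. *)
  rewrite -(@integral_reflect (phi (scons 0 g)) (fun x => F (scons x g))) //.
  - apply: eq_integral => x _; congr F; apply/funext => -[|i] //.
    rewrite /upd /=; congr (_ - _); rewrite -[RHS](phik _ x); congr phi.
    by apply/funext => -[].
  - apply: (mF _ _ (fun x : measurableTypeR R => scons x g)).
    exact: measurable_scons.
rewrite !iter_intS; apply: eq_integral => x _.
rewrite -[RHS](IH k (fun g => phi (scons x g)) (fun g => F (scons x g))) //.
- congr iter_int; apply/funext => g; congr F; apply/funext => -[|i] //=.
- exact: measurable_op_scons.
- exact: (measurable_op_scons (F := fun v => (phi v)%:E)).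
- move=> v y; rewrite -[RHS](phik _ y); congr phi.
  by apply/funext => -[].
Qed.

End IteratedIntegral.

(** * Symmetry of the simplex *)

Section SimplexSymmetry.
Context {R : realType} {n : nat}.
Implicit Types (v : nat -> R) (i j : 'I_n.+1).

Lemma theta_of_lt v i : (i < n)%N -> @theta_of R n.+1 v i = v i.
Proof. by rewrite /theta_of /= => ->. Qed.

Lemma theta_of_max v : @theta_of R n.+1 v ord_max = 1 - \sum_(k < n) v k.
Proof. by rewrite /theta_of /= ltnn. Qed.

Lemma sum_theta_of v : \sum_i @theta_of R n.+1 v i = 1.
Proof.
rewrite big_ord_recr /= theta_of_max.
have -> : \sum_(i < n) @theta_of R n.+1 v (widen_ord (leqnSn n) i) = \sum_(i < n) v i.
  by apply: eq_bigr => i _; apply: (theta_of_lt v (i := widen_ord (leqnSn n) i)) => /=.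
by rewrite addrC subrK.
Qed.

Lemma measurable_theta_of d (T : measurableType d) (g : T -> nat -> R) i :
  (forall k, measurable_fun [set: T] (g^~ k)) ->
  measurable_fun [set: T] (fun t => @theta_of R n.+1 (g t) i).
Proof.
move=> mg; rewrite /theta_of /=; case: (i < n)%N; first exact: mg.
apply: measurable_funB => //.
by apply: measurable_sum => k; apply: mg.
Qed.

Lemma measurable_op_theta (G : ('I_n.+1 -> R) -> \bar R) :
  measurable_op G -> measurable_op (fun v => G (theta_of v)).
Proof.
move=> mG d T g mg; apply: (mG _ _ (fun t => theta_of (g t))) => i.
exact: measurable_theta_of.
Qed.

Lemma measurable_op_reindex (I J : Type) (s : I -> J) (G : (I -> R) -> \bar R) :
  measurable_op G -> measurable_op (fun th => G (th \o s)).
Proof.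
by move=> mG d T g mg; apply: (mG _ _ (fun t => g t \o s)) => i; apply: mg.
Qed.

(* Exchanging [theta i] with the dependent last coordinate is the reflection
   [v i |-> (1 - \sum_(m != i) v m) - v i]. *)
Lemma theta_of_upd v i : (i < n)%N ->
  @theta_of R n.+1 (upd v i (1 - \sum_(m < n | (m : nat) != i) v m - v i)) =
  theta_of v \o tperm i ord_max.
Proof.
move=> lt_in; apply/funext => j.
have sumE (w : nat -> R) : \sum_(m < n) w m =
    w i + \sum_(m < n | (m : nat) != i) w m.
  by rewrite (bigD1 (Ordinal lt_in)).
have sum_upd x : \sum_(m < n | (m : nat) != i) upd v i x m =
    \sum_(m < n | (m : nat) != i) v m.
  by apply: eq_bigr => m /negbTE mi; rewrite /upd mi.
rewrite /comp; case: tpermP => [->|->|/eqP ji /eqP jn].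
- rewrite theta_of_max theta_of_lt // /upd eqxx sumE; ring.
- rewrite theta_of_max theta_of_lt // sumE {1}/upd eqxx.
  rewrite sum_upd; ring.
- have lt_jn : (j < n)%N.
    by rewrite ltn_neqAle -ltnS ltn_ord andbT.
  by rewrite !theta_of_lt // /upd ifN.
Qed.

Lemma iter_int_theta_perm (s : {perm 'I_n.+1}) (G : ('I_n.+1 -> R) -> \bar R) :
  measurable_op G -> (forall th, (0 <= G th)%E) ->
  iter_int n (fun v => G (theta_of v \o s)) =
  iter_int n (fun v => G (theta_of v)).
Proof.
(* Quantifying over [G] inside [inv] lets invariance under [t] be applied to the integrand reindexed
   by [s], which gives closure under products. *)
pose inv (s : {perm 'I_n.+1}) := forall G : ('I_n.+1 -> R) -> \bar R,
  measurable_op G -> (forall th, (0 <= G th)%E) ->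
  iter_int n (fun v => G (theta_of v \o s)) =
  iter_int n (fun v => G (theta_of v)).
move: s G; suff : forall s, inv s by [].
have inv1 : inv 1%g.
  move=> G _ _; congr iter_int; apply/funext => v; congr G.
  by apply/funext => i /=; rewrite perm1.
have invM s t : inv s -> inv t -> inv (s * t)%g.
  move=> hs ht G mG G0.
  rewrite -(hs G) // -(ht (fun th => G (th \o s))) //.
    congr iter_int; apply/funext => v; congr G.
    by apply/funext => i /=; rewrite permM.
  exact: measurable_op_reindex.
have invmax i : inv (tperm i ord_max).
  have [->|i_max] := eqVneq i ord_max; first by rewrite tperm1.
  have lt_in : (i < n)%N by rewrite ltn_neqAle -ltnS ltn_ord andbT.
  move=> G mG G0.
  rewrite -(@iter_int_reflect R n i
    (fun v => 1 - \sum_(m < n | (m : nat) != i) v m) (fun v => G (theta_of v))) //.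
  - by congr iter_int; apply/funext => v; rewrite theta_of_upd.
  - exact: measurable_op_theta.
  - move=> d T g mg; apply/measurable_EFinP; apply: measurable_funB => //.
    under eq_fun do rewrite big_mkcond.
    by apply: measurable_sum => m; case: (_ != _) => //; apply: mg.
  - move=> v x; congr (_ - _); apply: eq_bigr => m /negbTE mi.
    by rewrite /upd mi.
have invt i j : inv (tperm i j).
  have [->|ij] := eqVneq i j; first by rewrite tperm1.
  have [->|jm] := eqVneq j ord_max; first exact: invmax.
  have [->|im] := eqVneq i ord_max; first by rewrite tpermC; exact: invmax.
  (* Conjugating the exchange of [i] and the last index by that of [j] and the last index gives the
     exchange of [i] and [j]. *)
  have -> : tperm i j =
      (tperm j ord_max * (tperm i ord_max * tperm j ord_max))%g.
    have := tpermJ i ord_max (tperm j ord_max).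
    by rewrite /conjg tpermV tpermR tpermD 1?eq_sym.
  by apply/invM => //; apply/invM.
move=> s; have [ts -> _] := prod_tpermP s.
by elim: ts => [|t ts IH]; rewrite ?big_nil // big_cons; apply: invM.
Qed.

End SimplexSymmetry.

(** * Integrability of powers on []0, 1]] *)

Section PowerIntegral.
Context {R : realType}.
Local Notation mu := (@lebesgue_measure R).

Lemma derivable_powR (a x : R) : 0 < x -> derivable (fun y => y `^ a) x 1.
Proof. by move=> x0; have [] := is_derive1_powR a x0. Qed.

(** The antiderivative [a^-1 * x ^ a] gives [a^-1 * (1 - c ^ a)]; dropping the term in [c] leaves a
    bound uniform in [c]. *)
Lemma integral_powR_itv (a c : R) : 0 < a -> 0 < c -> c < 1 ->
  (\int[mu]_(x in `[c, 1%R]) (x `^ (a - 1))%R%:E <= (a^-1)%:E)%E.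
Proof.
move=> a0 c0 c1.
have pos x : c <= x -> 0 < x by apply: lt_le_trans.
have dF x : 0 < x -> derivable (fun y => a^-1 * y `^ a) x 1.
  by move=> x0; apply: derivableM => //; exact: derivable_powR.
have cF x : 0 < x -> {for x, continuous (fun y => a^-1 * y `^ a)}.
  by move=> x0; apply/differentiable_continuous/derivable1_diffP/dF.
rewrite (@continuous_FTC2 _ _ (fun x => a^-1 * x `^ a)) //.
- rewrite powR1 mulr1 -EFinD lee_fin gerBl.
  by rewrite mulr_ge0 ?powR_ge0 // invr_ge0 ltW.
- apply: derivable_within_continuous => x; rewrite in_itv/= => /andP[cx _].
  by apply: derivable_powR; apply: pos.
- split.
  + by move=> x; rewrite in_itv/= => /andP[/ltW cx _]; apply: dF; apply: pos.
  + by apply: cvg_at_right_filter; apply: cF.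
  + by apply: cvg_at_left_filter; apply: cF.
- move=> x; rewrite in_itv/= => /andP[/ltW /pos x0 _].
  rewrite derive1Ml; last exact: derivable_powR.
  have xE : x \in `]0, +oo[ by rewrite in_itv/= x0.
  by rewrite (powR_derive1 a xE) mulKf // gt_eqF.
Qed.

Lemma measurable_bool_natr d (T : measurableType d) (b : T -> bool) :
  measurable_fun [set: T] b -> measurable_fun [set: T] (fun t => (b t)%:R : R).
Proof.
move=> mb.
rewrite [X in measurable_fun _ X](_ : _ = fun t => if b t then 1 else 0 : R).
  exact: measurable_fun_ifT.
by apply/funext => t; case: (b t).
Qed.

Lemma measurable_powR_bool (a : R) :
  measurable_fun [set: R] (fun x : R => (0 < x <= 1)%R%:R * x `^ (a - 1)).
Proof.
apply: measurable_funM; last exact: measurable_powR.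
apply: measurable_bool_natr; apply: measurable_and.
  exact: measurable_fun_ltr.
exact: measurable_fun_ler.
Qed.

(** Monotone convergence along the intervals [[1/(k+2), 1]], which exhaust []0, 1]] and on each of
    which the integral is at most [a^-1]. *)
Lemma integral_powR01_lty (a : R) : 0 < a ->
  (\int[mu]_(x in [set: R]) ((0 < x <= 1)%R%:R * x `^ (a - 1))%R%:E < +oo)%E.
Proof.
move=> a0.
(* Starting at 1/2 keeps every left end strictly below 1, as [integral_powR_itv] requires. *)
pose F (k : nat) : set R := `[(k.+2%:R)^-1, 1]%classic.
have -> : (\int[mu]_(x in [set: R]) ((0 < x <= 1)%R%:R * x `^ (a - 1))%R%:E =
    \int[mu]_(x in \bigcup_k F k) (x `^ (a - 1))%R%:E)%E.
  rewrite [RHS]integral_mkcond; apply: eq_integral => x _.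
  rewrite patchE; case: ifPn => [|xF].
    rewrite inE => -[k _]; rewrite /F /= in_itv/= => /andP[kx ->].
    by rewrite (lt_le_trans _ kx) // mul1r.
  case: (boolP (0 < x <= 1)) => [/andP[x0 x1]|]; last by rewrite mul0r.
  case/negP: xF; rewrite inE.
  have [k kx] : exists k, k.+1%:R^-1 < x.
    exists (Num.trunc x^-1).
    by rewrite invf_plt ?posrE // truncnS_gt.
  exists k => //; rewrite /F /= in_itv/= x1 andbT.
  apply: le_trans (ltW kx).
  by rewrite lef_pV2 ?posrE // ler_nat.
have mF k : measurable (F k) by exact: measurable_itv.
have mf : measurable_fun [set: R] (fun x : R => (x `^ (a - 1))%R%:E).
  by apply/measurable_EFinP; exact: measurable_powR.
have cv : (\int[mu]_(x in F i) (x `^ (a - 1))%R%:E @[i --> \oo] -->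
    \int[mu]_(x in \bigcup_i F i) (x `^ (a - 1))%R%:E)%E.
  apply: ge0_nondecreasing_set_cvg_integral => //.
  - move=> i j ij; rewrite subsetEset => x; rewrite /F/= !in_itv/= => /andP[ix ->].
    by rewrite andbT (le_trans _ ix) // lef_pV2 ?posrE // ler_nat ltnS ltnS.
  - by move=> i; apply: measurable_funTS.
  - by move=> i x _; rewrite lee_fin powR_ge0.
rewrite -(cvg_lim _ cv) //.
apply: le_lt_trans (ltry a^-1).
apply: lime_le; first by apply/cvg_ex; eexists; exact: cv.
apply: nearW => k; apply: integral_powR_itv => //.
by rewrite invf_lt1 // ltr1n.
Qed.

(** Factoring out coordinate 0 at each step reduces the claim to one-dimensional integrals. *)
Lemma iter_int_prod_lty n (f : nat -> R -> R) :
  (forall k, measurable_fun [set: R] (f k)) -> (forall k x, 0 <= f k x) ->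
  (forall k, (\int[mu]_(x in [set: R]) (f k x)%:E < +oo)%E) ->
  (iter_int n (fun v => (\prod_(k < n) f k (v k))%:E) < +oo)%E.
Proof.
elim: n f => [|n IH] f mf f0 foo; first by rewrite /= big_ord0 ltry.
pose g k := f k.+1.
have mg : measurable_op (fun v : nat -> R => (\prod_(k < n) g k (v k))%:E).
  move=> d T v mv; apply/measurable_EFinP; apply: measurable_prod => k _.
  exact: (measurableT_comp (mf _) (mv _)).
have g0 (v : nat -> R) : (0 <= (\prod_(k < n) g k (v k))%:E)%E.
  by rewrite lee_fin; apply: prodr_ge0 => k _; apply: f0.
have I0 := iter_int_ge0 n g0.
have Ioo : (iter_int n (fun v => (\prod_(k < n) g k (v k))%:E) < +oo)%E.
  by apply: IH => k *; [exact: mf|exact: f0|exact: foo].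
have -> : iter_int n.+1 (fun v => (\prod_(k < n.+1) f k (v k))%:E) =
    ((\int[mu]_(x in [set: R]) (f 0%N x)%:E) *
     iter_int n (fun v => (\prod_(k < n) g k (v k))%:E))%E.
  rewrite iter_intS -ge0_integralZr //.
  - apply: eq_integral => x _; rewrite -iter_intZl //.
    by congr iter_int; apply/funext => v; rewrite big_ord_recl -EFinM.
  - by have/measurable_EFinP := mf 0%N.
  - by move=> x _; rewrite lee_fin.
have J0 : (0 <= \int[mu]_(x in [set: R]) (f 0%N x)%:E)%E.
  by apply: integral_ge0 => x _; rewrite lee_fin.
by rewrite lte_mul_pinfty ?ge0_fin_numE ?foo.
Qed.

End PowerIntegral.

(** * The unnormalized Dirichlet density *)

Section Weight.
Context {R : realType} {n : nat}.
Implicit Types (alpha th : 'I_n.+1 -> R) (i j : 'I_n.+1).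

(** Distributing the positivity test over the factors makes the density a plain product, easy to
    permute and to prove measurable; a single non-positive coordinate still annihilates it. *)
Definition weight alpha th : R :=
  \prod_i ((0 < th i)%R%:R * th i `^ (alpha i - 1)).

Lemma dir_weightE alpha v : dir_weight alpha v = weight alpha (theta_of v).
Proof.
rewrite /dir_weight /weight; case: ifPn => [/forallP pos|].
  by apply: eq_bigr => i _; rewrite pos mul1r.
by move/forallPn => [i /negbTE npos]; rewrite (bigD1 i) //= npos !mul0r.
Qed.

Lemma weight_ge0 alpha th : 0 <= weight alpha th.
Proof. by apply: prodr_ge0 => i _; rewrite mulr_ge0 ?powR_ge0. Qed.

Lemma weight_gt0 alpha th : (forall i, 0 < th i) -> 0 < weight alpha th.
Proof.
by move=> pos; apply: prodr_gt0 => i _; rewrite pos mul1r powR_gt0.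
Qed.

Lemma weight_eq0 alpha th i : th i <= 0 -> weight alpha th = 0.
Proof. by move=> thi; rewrite /weight (bigD1 i) //= ltNge thi !mul0r. Qed.

Lemma weight_perm (s : {perm 'I_n.+1}) alpha th :
  weight (alpha \o s) (th \o s) = weight alpha th.
Proof. by rewrite /weight [RHS](reindex_inj (@perm_inj _ s)). Qed.

Lemma weight_tperm i j alpha th :
  weight alpha (th \o tperm i j) = weight (alpha \o tperm i j) th.
Proof.
rewrite -[LHS](weight_perm (tperm i j)); congr weight.
by apply/funext => k /=; rewrite tpermK.
Qed.

Lemma measurable_weight d (T : measurableType d) alpha
    (g : T -> 'I_n.+1 -> R) :
  (forall i, measurable_fun [set: T] (g^~ i)) ->
  measurable_fun [set: T] (fun t => weight alpha (g t)).
Proof.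
move=> mg; apply: measurable_prod => i _; apply: measurable_funM.
  apply: measurable_bool_natr; apply: measurable_fun_ltr => //; exact: mg.
exact: (measurableT_comp (measurable_powR _) (mg i)).
Qed.

(* [c] collects [theta i * theta j] to the power [alpha j - 1] and the factors
   of the other coordinates. *)
Lemma weight_pos_pair i j alpha th : i != j -> (forall k, 0 < th k) ->
  exists2 c : R, 0 < c &
  weight alpha th = c * th i `^ (alpha i - alpha j) /\
  weight alpha (th \o tperm i j) = c * th j `^ (alpha i - alpha j).
Proof.
move=> ij pos.
pose E (a th : 'I_n.+1 -> R) :=
  \prod_(k | (k != i) && (k != j)) ((0 < th k)%R%:R * th k `^ (a k - 1)).
have split_ij (th' : 'I_n.+1 -> R) : (forall k, 0 < th' k) -> weight alpha th' =
    th' i `^ (alpha i - 1) * (th' j `^ (alpha j - 1) * E alpha th').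
  move=> pos'; rewrite /weight (bigD1 i) //= (bigD1 j) 1?eq_sym //=.
  by rewrite !pos' !mul1r.
exists (th i `^ (alpha j - 1) * (th j `^ (alpha j - 1) * E alpha th)).
  rewrite !mulr_gt0 ?powR_gt0 //; apply: prodr_gt0 => k _.
  by rewrite pos mul1r powR_gt0.
have powE x : 0 < x -> x `^ (alpha i - 1) =
    x `^ (alpha j - 1) * x `^ (alpha i - alpha j).
  move=> x0; rewrite -powRD; last by rewrite (gt_eqF x0) implybT.
  by congr powR; ring.
split; first by rewrite split_ij // powE //; ring.
rewrite split_ij => [|k]; last exact: pos.
rewrite /= tpermL tpermR powE //.
have -> : E alpha (th \o tperm i j) = E alpha th.
  by apply: eq_bigr => k /andP[ki kj] /=; rewrite tpermD // eq_sym.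
ring.
Qed.

(** For positive coordinates the two weights share a factor, and what remains is
    [x ^ (alpha i - alpha j)] at [x = th i] and at [x = th j], a non-decreasing function of [x]. *)
Lemma le_weight_tperm i j alpha th :
  alpha j <= alpha i -> th j < th i ->
  weight alpha (th \o tperm i j) <= weight alpha th.
Proof.
move=> aij thij.
have ij : i != j by apply: contraTneq thij => ->; rewrite ltxx.
have [/forallP pos|/forallPn [k]] := boolP [forall k, 0 < th k].
  have [c c0 [-> ->]] := weight_pos_pair alpha ij pos.
  rewrite ler_pM2l //; apply: ge0_ler_powR; rewrite ?nnegrE ?subr_ge0 //.
  - exact/ltW.
  - exact/ltW.
  - exact/ltW.
(* A non-positive coordinate survives the exchange and makes the left side 0. *)
rewrite -leNgt => thk.
by rewrite (@weight_eq0 _ _ (tperm i j k)) ?weight_ge0 //= tpermK.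
Qed.

Lemma lt_weight_tperm i j alpha th : (forall k, 0 < th k) ->
  alpha j < alpha i -> th j < th i ->
  weight alpha (th \o tperm i j) < weight alpha th.
Proof.
move=> pos aij thij.
have ij : i != j by apply: contraTneq aij => ->; rewrite ltxx.
have [c c0 [-> ->]] := weight_pos_pair alpha ij pos.
rewrite ltr_pM2l //; apply: gt0_ltr_powR; rewrite ?nnegrE ?subr_gt0 //.
- exact/ltW.
- exact/ltW.
Qed.

(** * Integrability of the density *)

Lemma weight_theta_bound alpha :
  exists2 C : R, 0 <= C & forall v : nat -> R,
  (n.+1%:R^-1 <= @theta_of R n.+1 v ord_max)%R%:R * weight alpha (theta_of v) <=
  C * \prod_(k < n) ((0 < v k <= 1)%R%:R * v k `^ (alpha (inord k) - 1)).
Proof.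
pose a := alpha ord_max - 1.
have N0 : 0 < n.+1%:R^-1 :> R by rewrite invr_gt0.
(* The last coordinate lies in [[1/(n+1), 1]], so its power [a] is at most 1 if [0 <= a] and at most
   [(1/(n+1)) ^ a] otherwise; the sum covers both signs. *)
exists (1 + n.+1%:R^-1 `^ a); first by rewrite addr_ge0 ?powR_ge0.
move=> v; set th := @theta_of R n.+1 v; set W := \prod_(k < n) _.
have W0 : 0 <= W by apply: prodr_ge0 => k _; rewrite mulr_ge0 ?powR_ge0.
have C0 : 0 <= 1 + n.+1%:R^-1 `^ a by rewrite addr_ge0 ?powR_ge0.
case: (boolP (n.+1%:R^-1 <= th ord_max)) => [thm|_]; last first.
  by rewrite mul0r mulr_ge0.
rewrite mul1r.
have [/forallP pos|/forallPn [k]] := boolP [forall k, 0 < th k]; last first.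
  by rewrite -leNgt => /weight_eq0 ->; rewrite mulr_ge0.
have le1 k : th k <= 1.
  rewrite -(@sum_theta_of R n v) (bigD1 k) //= lerDl.
  by apply: sumr_ge0 => m _; apply/ltW/pos.
rewrite /weight big_ord_recr /= mulrC pos mul1r -/a.
have -> : \prod_(k < n) ((0 < th (widen_ord (leqnSn n) k))%R%:R *
    th (widen_ord (leqnSn n) k) `^ (alpha (widen_ord (leqnSn n) k) - 1)) = W.
  apply: eq_bigr => k _.
  have thk : th (widen_ord (leqnSn n) k) = v k.
    by apply: (theta_of_lt v (i := widen_ord (leqnSn n) k)) => /=.
  rewrite pos -thk pos le1 !mul1r; congr (_ `^ (alpha _ - 1)).
  by apply/val_inj; rewrite /= inordK // ltnW // ltnS.
apply: ler_wpM2r => //.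
have [a0|a0] := leP 0 a.
  have : th ord_max `^ a <= 1 `^ a.
    by apply: ge0_ler_powR; rewrite ?nnegrE // ltW.
  by rewrite powR1 => /le_trans; apply; rewrite lerDl powR_ge0.
rewrite (le_trans (y := n.+1%:R^-1 `^ a)) ?lerDr //.
have [b aE] : exists b, a = - b by exists (- a); rewrite opprK.
rewrite aE oppr_lt0 in a0 *; rewrite !powRN lef_pV2 ?posrE ?powR_gt0 //.
apply: ge0_ler_powR; rewrite ?nnegrE ?(ltW a0) ?(ltW N0) //.
exact/ltW/pos.
Qed.

Lemma measurable_op_cond_weight alpha i :
  measurable_op (fun th => ((n.+1%:R^-1 <= th i)%R%:R * weight alpha th)%:E).
Proof.
move=> d T g mg; apply/measurable_EFinP; apply: measurable_funM.
  apply: measurable_bool_natr; apply: measurable_fun_ler => //; exact: mg.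
exact: measurable_weight.
Qed.

(** By symmetry the coordinate known to be large can be taken last, the parameters being permuted
    accordingly; [weight_theta_bound] then dominates the integrand. *)
Lemma iter_int_cond_weight_lty alpha i : (forall k, 0 < alpha k) ->
  (iter_int n (fun v =>
    ((n.+1%:R^-1 <= @theta_of R n.+1 v i)%R%:R * weight alpha (theta_of v))%:E)
  < +oo)%E.
Proof.
move=> a0.
pose G th := ((n.+1%:R^-1 <= th i)%R%:R * weight alpha th)%:E.
have G0 th : (0 <= G th)%E by rewrite lee_fin mulr_ge0 ?weight_ge0.
have mG : measurable_op G by exact: measurable_op_cond_weight.
rewrite -(iter_int_theta_perm (tperm i ord_max) mG G0) /G.
pose beta := alpha \o tperm i ord_max.
have b0 k : 0 < beta k by apply: a0.
have [C C0 CP] := weight_theta_bound beta.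
pose W (v : nat -> R) :=
  \prod_(k < n) ((0 < v k <= 1)%R%:R * v k `^ (beta (inord k) - 1)).
have W0 v : (0 <= (W v)%:E)%E.
  by rewrite lee_fin; apply: prodr_ge0 => k _; rewrite mulr_ge0 ?powR_ge0.
have mW : measurable_op (fun v => (W v)%:E).
  move=> d T g mg; apply/measurable_EFinP; apply: measurable_prod => k _.
  exact: (measurableT_comp (measurable_powR_bool _) (mg _)).
have Woo : (iter_int n (fun v => (W v)%:E) < +oo)%E.
  apply: (@iter_int_prod_lty R n
    (fun k x => (0 < x <= 1)%R%:R * x `^ (beta (inord k) - 1))) => k.
  - exact: measurable_powR_bool.
  - by move=> x; rewrite mulr_ge0 ?powR_ge0.
  - exact: integral_powR01_lty.
apply: (@le_lt_trans _ _ (iter_int n (fun v => C%:E * (W v)%:E)%E)).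
  apply: le_iter_int.
  - exact: (measurable_op_theta (measurable_op_reindex _ mG)).
  - by move=> d T g mg; apply: emeasurable_funM => //; exact: mW.
  - by move=> v; apply: (G0 (theta_of v \o tperm i ord_max)).
  - move=> v; rewrite -EFinM lee_fin /= tpermL weight_tperm; exact: CP.
by rewrite iter_intZl // lte_mul_pinfty // ge0_fin_numE.
Qed.

(* The coordinates sum to 1, so one of them is at least 1/(n+1). *)
Lemma iter_int_weight_lty alpha : (forall k, 0 < alpha k) ->
  (iter_int n (fun v => (weight alpha (@theta_of R n.+1 v))%:E) < +oo)%E.
Proof.
move=> a0.
pose G i v := ((n.+1%:R^-1 <= @theta_of R n.+1 v i)%R%:R * weight alpha (theta_of v))%:E.
have mG i : measurable_op (G i).
  exact: (measurable_op_theta (measurable_op_cond_weight alpha i)).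
have G0 i v : (0 <= G i v)%E by rewrite lee_fin mulr_ge0 ?weight_ge0.
apply: (@le_lt_trans _ _ (iter_int n (fun v => \sum_i G i v)%E)); last first.
  rewrite iter_int_sum // lte_sum_pinfty // => i _.
  exact: iter_int_cond_weight_lty.
apply: le_iter_int.
- move=> d T g mg; apply/measurable_EFinP; apply: measurable_weight => i.
  exact: measurable_theta_of.
- exact: measurable_op_sum.
- by move=> v; rewrite lee_fin weight_ge0.
move=> v.
have [i thi] : exists i, n.+1%:R^-1 <= @theta_of R n.+1 v i.
  apply/not_existsP => thlt.
  have : \sum_i @theta_of R n.+1 v i < \sum_(i < n.+1) n.+1%:R^-1.
    apply: ltr_sum => [|i _]; first by apply/hasP; exists ord0; rewrite ?mem_index_enum.
    by rewrite ltNge; apply/negP/thlt.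
  by rewrite sum_theta_of sumr_const card_ord -[_ *+ _]mulr_natr mulVf ?ltxx //.
rewrite (bigD1 i) //= /G thi mul1r leeDl // sume_ge0 // => j _.
exact: G0.
Qed.

End Weight.

(** * Optimal rankings *)

Section PairwiseScore.
Context {R : realType} {K : nat}.
Variables (alpha : 'I_K -> R) (q : 'I_K -> 'I_K -> R).
Implicit Types (pi sigma : {perm 'I_K}) (i j : 'I_K).

(** For [q i j] the mass of [theta j < theta i], this is the expected agreement up to a positive
    factor; an abstract [q] isolates the combinatorics. *)
Definition score pi : R := \sum_i \sum_j ((pi j : nat) < pi i)%N%:R * q i j.

Let pair_score pi i j : R :=
  ((pi j : nat) < pi i)%N%:R * q i j + ((pi i : nat) < pi j)%N%:R * q j i.

(** Exchanging the summation indices in one of two copies of the score gathers the two terms of each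
    pair, so that rankings can be compared pair by pair. *)
Let double_score pi : 2 * score pi = \sum_i \sum_j pair_score pi i j.
Proof.
rewrite mulr_natl mulr2n {2}/score exchange_big /score -big_split /=.
by apply: eq_bigr => i _; rewrite -big_split.
Qed.

(** Rank each index by its position in the list of indices sorted by increasing [alpha]. *)
Lemma exists_Pi_alpha : exists sigma, Pi_alpha alpha sigma.
Proof.
pose leT := [rel i j | alpha i <= alpha j].
pose s := sort leT (enum 'I_K).
have s_mem i : i \in s by rewrite mem_sort mem_enum.
have idx_lt i : (index i s < K)%N.
  by have := s_mem i; rewrite -index_mem size_sort size_enum_ord.
have idx_inj : injective (fun i => Ordinal (idx_lt i)).
  move=> i j [] ij; rewrite -(nth_index i (s_mem i)) ij nth_index //.
exists (perm idx_inj) => i j; rewrite !permE /= => ji.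
have leT_tr : transitive leT by move=> y x z; apply: le_trans.
have s_sorted : sorted leT s by apply: sort_sorted => x y; apply: le_total.
exact: (sorted_ltn_index leT_tr s_sorted j i (s_mem j) (s_mem i) ji).
Qed.

Hypothesis le_q : forall i j, alpha j <= alpha i -> q j i <= q i j.
Hypothesis lt_q : forall i j, alpha j < alpha i -> q j i < q i j.

(** On each pair a ranking collects one of [q i j] and [q j i], and membership in [Pi_alpha] forces
    the larger one. *)
Let le_pair_score pi sigma i j :
  Pi_alpha alpha pi -> pair_score sigma i j <= pair_score pi i j.
Proof.
move=> Ppi; have [->|ij] := eqVneq i j; first by rewrite /pair_score !ltnn.
have neq (tau : {perm 'I_K}) : (tau i : nat) != tau j.
  by apply: contra_neq ij => /val_inj/perm_inj.
have := Ppi i j; have := Ppi j i; rewrite /pair_score.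
have [s1|s1|/eqP] := ltngtP (sigma i) (sigma j); last by rewrite (negbTE (neq _)).
all: have [p1|p1|/eqP] := ltngtP (pi i) (pi j); last by rewrite (negbTE (neq _)).
all: rewrite !mul0r !mul1r ?add0r ?addr0 => // H1 H2.
- by apply: le_q; apply: H2.
- by apply: le_q; apply: H1.
Qed.

(** Forwards, compare pair by pair. Conversely, if [pi] ranks [i] above [j] although
    [alpha i < alpha j], a sorted ranking does at least as well on every pair and strictly better on
    this one. *)
Lemma Pi_alpha_argmax pi :
  Pi_alpha alpha pi <-> (forall sigma, score sigma <= score pi).
Proof.
have dle sigma tau : (score sigma <= score tau) = (2 * score sigma <= 2 * score tau).
  by rewrite ler_pM2l.
split=> [Ppi sigma|max_pi i j pij].
  rewrite dle !double_score; apply: ler_sum => i _; apply: ler_sum => j _.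
  exact: le_pair_score.
rewrite leNgt; apply/negP => aij.
have [sigma Ps] := exists_Pi_alpha.
suff : score pi < score sigma by rewrite ltNge max_pi.
rewrite -(ltr_pM2l (ltr0Sn R 1)) !double_score.
have ltij : pair_score pi i j < pair_score sigma i j.
  have sij : (sigma i < sigma j)%N.
    rewrite ltn_neqAle leqNgt; apply/andP; split; last first.
      by apply/negP => /Ps; rewrite leNgt aij.
    apply: contraTneq pij => /val_inj/perm_inj ->; by rewrite ltnn.
  rewrite /pair_score pij sij ltnNge (ltnW pij) ltnNge (ltnW sij) /=.
  by rewrite !mul0r !mul1r addr0 add0r lt_q.
rewrite (bigD1 i) //= [ltRHS](bigD1 i) //=; apply: ltr_leD.
  rewrite (bigD1 j) //= [ltRHS](bigD1 j) //=; apply: ltr_leD => //.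
  by apply: ler_sum => k _; exact: le_pair_score.
by apply: ler_sum => k _; apply: ler_sum => l _; exact: le_pair_score.
Qed.

End PairwiseScore.

(** * Pairwise probabilities and the expected agreement *)

Section PairwiseProbability.
Context {R : realType} {n : nat}.
Variable alpha : 'I_n.+1 -> R.
Implicit Types (th : 'I_n.+1 -> R) (i j : 'I_n.+1).

Definition pair_weight i j th : R := (th j < th i)%R%:R * weight alpha th.

Lemma pair_weight_ge0 i j th : 0 <= pair_weight i j th.
Proof. by rewrite mulr_ge0 ?weight_ge0. Qed.

Lemma measurable_pair_weight i j d (T : measurableType d)
    (g : T -> 'I_n.+1 -> R) :
  (forall i, measurable_fun [set: T] (g^~ i)) ->
  measurable_fun [set: T] (fun t => pair_weight i j (g t)).
Proof.
move=> mg; apply: measurable_funM; last exact: measurable_weight.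
by apply: measurable_bool_natr; apply: measurable_fun_ltr; exact: mg.
Qed.

Lemma measurable_op_pair_weight i j :
  measurable_op (fun th => (pair_weight i j th)%:E).
Proof.
by move=> d T g mg; apply/measurable_EFinP; exact: measurable_pair_weight.
Qed.

(** The probability of [theta j < theta i] before division by [dir_const]. *)
Definition pair_mass i j : \bar R :=
  iter_int n (fun v => (pair_weight i j (theta_of v))%:E).

Lemma pair_mass_ge0 i j : (0 <= pair_mass i j)%E.
Proof. by apply: iter_int_ge0 => v; rewrite lee_fin pair_weight_ge0. Qed.

Lemma pair_mass_swap i j : pair_mass j i =
  iter_int n (fun v => (pair_weight j i (theta_of v \o tperm i j))%:E).
Proof.
rewrite (iter_int_theta_perm (tperm i j) (measurable_op_pair_weight j i)) //.
by move=> th; rewrite lee_fin pair_weight_ge0.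
Qed.

Lemma pair_weight_tperm i j th : pair_weight j i (th \o tperm i j) =
  (th j < th i)%R%:R * weight alpha (th \o tperm i j).
Proof. by rewrite /pair_weight /= tpermL tpermR. Qed.

(** The exchange carries the event [theta i < theta j] to [theta j < theta i], so both sides live on
    one event and only the weights differ. *)
Lemma le_pair_weight_tperm i j th : alpha j <= alpha i ->
  pair_weight j i (th \o tperm i j) <= pair_weight i j th.
Proof.
move=> aij; rewrite pair_weight_tperm /pair_weight.
case: (boolP (th j < th i)) => [thij|_]; last by rewrite !mul0r.
by rewrite !mul1r le_weight_tperm.
Qed.

(* On this box [theta i > 1/2] dominates, whether or not [i] is the last index. *)
Lemma theta_of_box i (v : nat -> R) :
  (forall k, (k < n)%N ->
    (if k == i then 2^-1 else 0) < v k <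
    (if k == i then 3 / 4 else (4 * n.+1%:R)^-1)) ->
  (forall k, 0 < @theta_of R n.+1 v k) /\
  (forall j, j != i -> @theta_of R n.+1 v j < theta_of v i).
Proof.
move=> box; set e : R := (4 * n.+1%:R)^-1 in box.
have e0 : 0 < e by rewrite invr_gt0 mulr_gt0.
(* Hence [n * e < 1/4]: the small coordinates sum to less than 1/4, which keeps the last coordinate
   positive when [v i < 3/4], and above 3/4 when [i] is the last index. *)
have ne : n%:R * e + e = 4^-1.
  have -> : n%:R * e + e = n.+1%:R * e by rewrite -natr1 mulrDl mul1r.
  by rewrite /e invfM mulrCA mulfV ?mulr1 // pnatr_eq0.
have n0 : 0 <= n%:R * e by rewrite mulr_ge0 // ltW.
pose s := \sum_(m < n | (m : nat) != i) v m.
have s0 : 0 <= s.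
  apply: sumr_ge0 => m mi; have := box m (ltn_ord m).
  by rewrite (negbTE mi) => /andP[/ltW].
have s1 : s <= n%:R * e.
  rewrite mulr_natl -[n in leRHS]card_ord -sumr_const /s big_mkcond /=.
  apply: ler_sum => m _; case: ifPn => [mi|_]; last exact/ltW.
  by have := box m (ltn_ord m); rewrite (negbTE mi) => /andP[_ /ltW].
have lt_max (k : 'I_n.+1) : k != ord_max -> (k < n)%N.
  by move=> kn; rewrite ltn_neqAle -ltnS ltn_ord andbT.
have small (k : 'I_n.+1) : k != i -> k != ord_max -> 0 < @theta_of R n.+1 v k < e.
  move=> ki /lt_max kn; rewrite theta_of_lt //.
  by have := box k kn; rewrite (negbTE (_ : (k : nat) != i)).
have [imax|im] := eqVneq i ord_max.
  have thmax : @theta_of R n.+1 v ord_max = 1 - s.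
    rewrite theta_of_max /s; congr (_ - _); apply: eq_bigl => m.
    by rewrite imax /= neq_ltn ltn_ord.
  split=> k; last first.
    by move=> ki; have := small k ki; rewrite -imax ki imax thmax => /(_ isT); lra.
  have [->|ki] := eqVneq k ord_max; first by rewrite thmax; lra.
  by have := small k; rewrite imax ki => /(_ isT isT) /andP[].
have vi : 2^-1 < v i < 3 / 4 by have := box i (lt_max i im); rewrite eqxx.
have thi : theta_of v i = v i by rewrite theta_of_lt ?lt_max.
have thmax : @theta_of R n.+1 v ord_max = 1 - (v i + s).
  by rewrite theta_of_max (bigD1 (Ordinal (lt_max i im))).
split=> k.
  have [->|km] := eqVneq k ord_max; first by rewrite thmax; lra.
  have [->|ki] := eqVneq k i; first by rewrite thi; lra.
  by have /andP[] := small k ki km.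
move=> ki; rewrite thi.
have [->|km] := eqVneq k ord_max; first by rewrite thmax; lra.
by have := small k ki km; lra.
Qed.

Lemma iter_int_theta_gt0 i (F : ('I_n.+1 -> R) -> \bar R) :
  measurable_op F -> (forall th, (0 <= F th)%E) ->
  (forall th, (forall k, 0 < th k) -> (forall j, j != i -> th j < th i) ->
    (0 < F th)%E) ->
  (0 < iter_int n (fun v => F (theta_of v)))%E.
Proof.
move=> mF F0 Fp; apply: (@iter_int_gt0 R n _
  (fun k => if k == i then 2^-1 else 0)
  (fun k => if k == i then 3 / 4 else (4 * n.+1%:R)^-1)).
- exact: measurable_op_theta.
- by move=> v; apply: F0.
- move=> k _; case: ifP => _; first lra.
  by rewrite invr_gt0 mulr_gt0.
- by move=> v /theta_of_box[pos lt_i]; apply: Fp.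
Qed.

Lemma le_pair_mass i j : alpha j <= alpha i ->
  (pair_mass j i <= pair_mass i j)%E.
Proof.
move=> aij; rewrite pair_mass_swap; apply: le_iter_int.
- exact: (measurable_op_theta (measurable_op_reindex _ (measurable_op_pair_weight j i))).
- exact: (measurable_op_theta (measurable_op_pair_weight i j)).
- by move=> v; rewrite lee_fin pair_weight_ge0.
- by move=> v; rewrite lee_fin le_pair_weight_tperm.
Qed.

Hypothesis alpha_gt0 : forall i, 0 < alpha i.

(** Each mass is bounded by the integral of the whole density. *)
Lemma pair_mass_fin_num i j : pair_mass i j \is a fin_num.
Proof.
rewrite ge0_fin_numE ?pair_mass_ge0 //.
apply: le_lt_trans (iter_int_weight_lty alpha_gt0); apply: le_iter_int.
- exact: (measurable_op_theta (measurable_op_pair_weight i j)).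
- move=> d T g mg; apply/measurable_EFinP; apply: measurable_weight => k.
  exact: measurable_theta_of.
- by move=> v; rewrite lee_fin pair_weight_ge0.
- move=> v; rewrite lee_fin /pair_weight; case: (_ < _); rewrite ?mul1r // mul0r.
  exact: weight_ge0.
Qed.

Lemma lt_pair_mass i j : alpha j < alpha i -> (pair_mass j i < pair_mass i j)%E.
Proof.
move=> aij.
have ji : j != i by apply: contraTneq aij => ->; rewrite ltxx.
(* The gap between the masses is the integral of the nonnegative [D], which is positive where all
   coordinates are positive and [theta i] dominates. As [pair_mass j i] is finite, adding this
   positive integral is strict. *)
pose D th := (pair_weight i j th - pair_weight j i (th \o tperm i j))%:E.
have mD : measurable_op D.
  move=> d T g mg; apply/measurable_EFinP; apply: measurable_funB.
    exact: measurable_pair_weight.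
  apply: (measurable_pair_weight j i (g := fun t => g t \o tperm i j)) => k.
  exact: mg.
have D0 th : (0 <= D th)%E by rewrite lee_fin subr_ge0 le_pair_weight_tperm // ltW.
have -> : pair_mass i j =
    (pair_mass j i + iter_int n (fun v => D (theta_of v)))%E.
  rewrite (pair_mass_swap i j) -iter_intD.
  - congr iter_int; apply/funext => v.
    by rewrite /D -EFinD addrC subrK.
  - exact: (measurable_op_theta (measurable_op_reindex _ (measurable_op_pair_weight j i))).
  - exact: measurable_op_theta.
  - by move=> v; rewrite lee_fin pair_weight_ge0.
  - by move=> v; apply: D0.
rewrite lteDl ?pair_mass_fin_num //.
apply: (@iter_int_theta_gt0 i) => // th pos lt_i.
by rewrite lte_fin subr_gt0 pair_weight_tperm /pair_weight lt_i // !mul1r lt_weight_tperm // lt_i.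
Qed.

Lemma dir_const_gt0 : 0 < dir_const alpha.
Proof.
rewrite /dir_const /=.
under [X in iter_int _ X]eq_fun do rewrite dir_weightE.
have mw : measurable_op (fun th => (weight alpha th)%:E).
  by move=> d T g mg; apply/measurable_EFinP; exact: measurable_weight.
(* [fine] sends [+oo] to 0, so the integral has to be finite as well as positive. *)
rewrite fine_gt0 // iter_int_weight_lty // andbT.
apply: (@iter_int_theta_gt0 ord_max _ mw) => th.
  by rewrite lee_fin weight_ge0.
by move=> pos _; rewrite lte_fin weight_gt0.
Qed.

(** Linearity of the integral, applied to a sum over ordered pairs whose coefficients [C * b p] are
    nonnegative. *)
Lemma exp_tauE pi : exp_tau alpha pi =
  (2 / (n.+1%:R * (n.+1%:R - 1)) / dir_const alpha *
   score (fun i j => fine (pair_mass i j)) pi)%:E.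
Proof.
set c := 2 / _; pose C := c / dir_const alpha.
pose b (p : 'I_n.+1 * 'I_n.+1) : R := ((pi p.2 : nat) < pi p.1)%N%:R.
pose F p v := ((C * b p)%:E * (pair_weight p.1 p.2 (@theta_of R n.+1 v))%:E)%E.
have C0 : 0 <= C.
  rewrite divr_ge0 ?(ltW dir_const_gt0) // divr_ge0 // mulr_ge0 //.
have Cb0 p : 0 <= C * b p by rewrite mulr_ge0.
have mpw p : measurable_op
    (fun v : nat -> R => (pair_weight p.1 p.2 (@theta_of R n.+1 v))%:E).
  exact: (measurable_op_theta (measurable_op_pair_weight p.1 p.2)).
transitivity (iter_int n (fun v => \sum_p F p v)%E).
  congr iter_int; apply/funext => v; rewrite /F.
  under eq_bigr do rewrite -EFinM.
  rewrite sumEFin; congr EFin.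
  rewrite dir_weightE -(pair_bigA _ (fun i j =>
    C * b (i, j) * pair_weight i j (theta_of v))) /=.
  set w := weight _ _.
  have -> : ktau pi (@theta_of R n.+1 v) * (w / dir_const alpha) = C * w *
      \sum_i \sum_(j | i != j) (((pi j : nat) < pi i)%N &&
        (@theta_of R n.+1 v j < theta_of v i))%R%:R.
    by rewrite /ktau -/c /C; ring.
  rewrite mulr_sumr; apply: eq_bigr => i _.
  rewrite mulr_sumr big_mkcond; apply: eq_bigr => j _.
  rewrite /b /pair_weight -/w /=.
  (* The diagonal, left out of [ktau], contributes 0 to [score] because [pi i < pi i] is false. *)
  have [->|ij] := eqVneq i j; first by rewrite /= ltnn !(mulr0, mul0r).
  by case: (pi j < pi i)%N; case: (_ < _); rewrite /= ?(mulr1, mulr0, mul0r, mul1r).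
rewrite iter_int_sum //; last 2 first.
- by move=> p d T g mg; apply: emeasurable_funM => //; exact: mpw.
- by move=> p v; rewrite mule_ge0 // lee_fin ?pair_weight_ge0.
transitivity (\sum_p (C * b p * fine (pair_mass p.1 p.2))%:E)%E.
  apply: eq_bigr => p _; rewrite iter_intZl //; last first.
    by move=> v; rewrite lee_fin pair_weight_ge0.
  by rewrite -/(pair_mass _ _) [RHS]EFinM fineK ?pair_mass_fin_num.
rewrite sumEFin; congr EFin.
rewrite -(pair_bigA _ (fun i j => C * b (i, j) * fine (pair_mass i j))) /=.
rewrite /score mulr_sumr; apply: eq_bigr => i _; rewrite mulr_sumr.
by apply: eq_bigr => j _; rewrite mulrA.
Qed.

End PairwiseProbability.

Theorem theorem1 (R : realType) (K : nat) (hK : (2 <= K)%N)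
    (alpha : 'I_K -> R) (halpha : forall i, 0 < alpha i) (pi : {perm 'I_K}) :
  Pi_alpha alpha pi <->
  (forall sigma : {perm 'I_K}, (exp_tau alpha sigma <= exp_tau alpha pi)%E).
Proof.
case: K hK alpha halpha pi => [//|n] hK alpha halpha pi.
rewrite (@Pi_alpha_argmax R n.+1 alpha (fun i j => fine (pair_mass alpha i j))).
(* Since [2 <= K], the factor [K - 1] is positive, so the scaling constant is positive and cancels
   from the comparison. *)
- have C0 : 0 < 2 / (n.+1%:R * (n.+1%:R - 1)) / dir_const alpha.
    rewrite divr_gt0 ?dir_const_gt0 // divr_gt0 // mulr_gt0 //.
    by rewrite subr_gt0 ltr1n.
  by split=> h sigma; have := h sigma; rewrite !exp_tauE // lee_fin ler_pM2l.
(* The masses are finite, so [fine] keeps both their weak and their strict comparisons. *)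
- move=> i j aij; apply: fine_le; rewrite ?pair_mass_fin_num //.
  exact: le_pair_mass.
- move=> i j aij; apply: fine_lt; rewrite ?pair_mass_fin_num //.
  exact: lt_pair_mass.
Qed.
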